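(* Let $r,p,q\ge 1$ be integers and let $$G = G(r,p,q) = K_1 \oplus \bigl(pK_r \cup q(K_1 \oplus (K_1 \cup K_2))\bigr).$$ Then the second largest distance eigenvalue of $G(r,p,q)$ satisfies $\lambda_2(G(r,p,q)) < -1/2$.
   Context: $K_m$ is the complete graph on $m$ vertices. $\cup$ denotes disjoint union of graphs, $mH$ is the disjoint union of $m$ copies of $H$, and $G_1\oplus G_2$ is the join: the disjoint union of $G_1$ and $G_2$ together with all edges between vertices of $G_1$ and vertices of $G_2$. For a connected graph $G$ with vertices $v_1,\dots,v_n$, $d_G(u,v)$ is the length of a shortest path between $u$ and $v$, the distance matrix is $\mathbf{D}(G)=[d_G(v_i,v_j)]$, and its (real) eigenvalues (the distance eigenvalues of $G$), counted with multiplicity, are ordered $\lambda_1(G)\ge\lambda_2(G)\ge\cdots\ge\lambda_n(G)$. *)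

(* Defs.v *)
From HB Require Import structures.
From mathcomp Require Import all_boot all_order all_algebra.
From mathcomp Require Import polyrcf.

Set Implicit Arguments.
Unset Strict Implicit.
Unset Printing Implicit Defensive.

Import Order.TTheory GRing.Theory Num.Theory.
Local Open Scope ring_scope.

Record sgraph := SGraph {
  svertex :> finType;
  sedge : rel svertex;
  sedge_sym : symmetric sedge;
  sedge_irr : irreflexive sedge
}.

Section Constructions.
Variables (m : nat) (G1 G2 : sgraph).

Definition complete_edge : rel 'I_m := fun x y => x != y.

Lemma complete_edge_sym : symmetric complete_edge.
Proof. by move=> x y; rewrite /complete_edge eq_sym. Qed.

Lemma complete_edge_irr : irreflexive complete_edge.
Proof. by move=> x; rewrite /complete_edge eqxx. Qed.

Definition complete_graph : sgraph :=
  SGraph complete_edge_sym complete_edge_irr.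

(* [cross] tells whether the edges between G1 and G2 are all present (join) or
   all absent (disjoint union). *)
Definition sum_edge (cross : bool) : rel (G1 + G2)%type := fun x y =>
  match x, y with
  | inl a, inl b => sedge a b
  | inr a, inr b => sedge a b
  | _, _ => cross
  end.

Lemma sum_edge_sym cross : symmetric (sum_edge cross).
Proof. by move=> [a|a] [b|b] //=; exact: sedge_sym. Qed.

Lemma sum_edge_irr cross : irreflexive (sum_edge cross).
Proof. by move=> [a|a] /=; exact: sedge_irr. Qed.

Definition disjoint_union : sgraph :=
  SGraph (sum_edge_sym false) (sum_edge_irr false).

Definition join_graph : sgraph :=
  SGraph (sum_edge_sym true) (sum_edge_irr true).

Definition copies_edge : rel ('I_m * G1)%type :=
  fun x y => (x.1 == y.1) && sedge x.2 y.2.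

Lemma copies_edge_sym : symmetric copies_edge.
Proof. by move=> x y; rewrite /copies_edge eq_sym sedge_sym. Qed.

Lemma copies_edge_irr : irreflexive copies_edge.
Proof. by move=> x; rewrite /copies_edge sedge_irr andbF. Qed.

Definition copies : sgraph := SGraph copies_edge_sym copies_edge_irr.

End Constructions.

Section Distance.
Variable G : sgraph.

Definition walk_of_length (u v : G) (k : nat) : bool :=
  [exists w : k.-tuple G, path (@sedge G) u w && (last u w == v)].

(* A shortest path has fewer than #|G| edges, so the search may stop there; the
   value is #|G| when u and v lie in different components. *)
Definition gdist (u v : G) : nat := find (walk_of_length u v) (iota 0 #|G|).

Definition dist_mx (R : pzRingType) : 'M[R]_#|G| :=
  \matrix_(i, j) (gdist (enum_val i) (enum_val j))%:R.

End Distance.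

(* The roots in R of the characteristic polynomial, in nonincreasing order and
   repeated according to multiplicity; rootsR lists the distinct roots in
   increasing order. *)
Definition eigenvalues (R : rcfType) (n : nat) (A : 'M[R]_n) : seq R :=
  flatten [seq nseq (mup x (char_poly A)) x | x <- rev (rootsR (char_poly A))].

(* The eigenvalues are numbered from 1. *)
Definition dist_eigenvalue (R : rcfType) (G : sgraph) (k : nat) : R :=
  (eigenvalues (dist_mx G R))`_k.-1.

Definition graph_rpq (r p q : nat) : sgraph :=
  join_graph (complete_graph 1)
    (disjoint_union
       (copies p (complete_graph r))
       (copies q (join_graph (complete_graph 1)
                    (disjoint_union (complete_graph 1) (complete_graph 2))))).

(* Main.v *)
(* In a cone K_1 + H all distances are at most 2, so D = 2 J - 2 I - A.  Writing
   t for the entry of a vector at the apex, y for the others and S for the sum of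
   y, this gives
     x (D + I / 2) x^T = (t + 2 S)^2 / 2 - y (A(H) + 3/2 I) y^T.
   If all adjacency eigenvalues of H exceed -3/2, the form is therefore negative
   on the hyperplane t + 2 S = 0, and D has at most one eigenvalue >= -1/2.  Here
   H is a disjoint union of complete graphs and of paws K_1 + (K_1 u K_2). *)
Require Import Defs.
From mathcomp Require Import all_boot all_order all_algebra.
From mathcomp Require Import polyrcf complex ring lra.

Import Order.TTheory GRing.Theory Num.Theory.
Local Open Scope ring_scope.

(** * Spectral theory of symmetric matrices over a real closed field *)

(** Over [R[i]] the matrix is hermitian, so the spectral theorem applies and the eigenvalues are
    real; [real_similar] then turns the complex similarity between two real matrices into a real
    one. Only invertibility of [P] survives this descent, not orthogonality of its rows. *)
Lemma real_symmetric_diagonalizable (R : rcfType) (n : nat) (A : 'M[R]_n) :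
  A^T = A ->
  exists2 P : 'M[R]_n, P \in unitmx & exists d : 'rV[R]_n, P *m A = diag_mx d *m P.
Proof.
move=> symA; pose toC := real_complex R; pose AC : 'M[R[i]]_n := map_mx toC A.
have ReC (x : R[i]) : x \is Num.real -> toC (complex.Re x) = x.
  exact: RRe_real.
have realC m k (B : 'M[R[i]]_(m, k)) : B \is a mxOver Num.real ->
    exists B', B = map_mx toC B'.
  move=> /mxOverP realB; exists (map_mx (@complex.Re R) B).
  by apply/matrixP=> i j; rewrite !mxE ReC.
have realA : AC \is a mxOver Num.real.
  by apply/mxOverP=> i j; rewrite mxE complex_real.
have hermA : AC \is hermsymmx.
  apply: realsym_hermsym realA; apply/is_hermitianmxP.
  by rewrite expr0 scale1r /AC -[in LHS]symA; apply/matrixP=> i j; rewrite !mxE.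
have /orthomx_spectralP defA := hermitian_normalmx hermA.
have [d def_d] := realC _ _ _ (hermitian_spectral_diag_real hermA).
have realD : diag_mx (spectral_diag AC) \is a mxOver Num.real.
  rewrite def_d -map_diag_mx; apply/mxOverP=> i j.
  by rewrite mxE complex_real.
have simA : similar_in unitmx AC (diag_mx (spectral_diag AC)).
  exists (spectralmx AC); rewrite ?spectral_unit //.
  apply/similarP; rewrite ?spectral_unit // {2}defA !mulmxA.
  by rewrite mulmxV ?spectral_unit // mul1mx.
have [P /andP[realP unitP] eqP] := real_similar simA realA realD.
have [Q defP] := realC _ _ _ realP; exists Q.
  by move: unitP; rewrite /= defP map_unitmx.
exists d; apply: (@map_mx_inj _ _ toC); rewrite !map_mxM map_diag_mx.
rewrite -def_d -defP; apply/similarP => //.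
Qed.

Lemma char_poly_diagonalized (R : idomainType) (n : nat) (A P : 'M[R]_n)
    (d : 'rV[R]_n) :
  P \in unitmx -> P *m A = diag_mx d *m P ->
  char_poly A = \prod_(i < n) ('X - (d 0 i)%:P).
Proof.
move=> unitP PA.
have <- : char_poly (diag_mx d) = \prod_(i < n) ('X - (d 0 i)%:P).
  rewrite char_poly_trig ?diag_mx_is_trig //.
  by apply: eq_bigr => i _; rewrite mxE eqxx.
have unitQ : map_mx polyC P \in unitmx.
  by rewrite unitmxE det_map_mx rmorph_unit // -unitmxE.
rewrite /char_poly.
suff <- : map_mx polyC P *m char_poly_mx A *m invmx (map_mx polyC P) =
          char_poly_mx (diag_mx d).
  by rewrite !det_mulmx mulrAC -det_mulmx mulmxV // det1 mul1r.
apply: (can_inj (mulmxK unitQ)); rewrite mulmxKV //.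
by rewrite /char_poly_mx mulmxBr mulmxBl -!map_mxM PA scalar_mxC.
Qed.

(** Both lists contain each [x] exactly [mup x (char_poly A)] times; for a non-root this number is
    0. *)
Lemma perm_eigenvalues (R : rcfType) (n : nat) (A : 'M[R]_n) (s : seq R) :
  char_poly A = \prod_(x <- s) ('X - x%:P) -> perm_eq (eigenvalues A) s.
Proof.
move=> splitA; have nzA : char_poly A != 0 by rewrite monic_neq0 ?char_poly_monic.
apply/allP=> x _ /=; apply/eqP; rewrite /eigenvalues count_flatten -map_comp.
rewrite -mu_prod_XsubC -splitA sumnE big_map.
under eq_bigr => y _ do rewrite /= count_nseq /=.
rewrite big_rev.
have uniq_roots : uniq (rootsR (char_poly A)).
  exact: (sorted_uniq lt_trans ltxx (sorted_roots _ _ _)).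
have [rx|nrx] := boolP (x \in rootsR (char_poly A)).
  rewrite (bigD1_seq x) //= eqxx mul1n big1 ?addn0 //.
  by move=> y /negbTE; rewrite eq_sym => ->.
rewrite big_seq big1 => [|y ry].
  by rewrite mupNroot // -[root _ _]/(true && _) roots_on_rootsR ?in_itv.
by case: eqP ry nrx => // -> ->.
Qed.

Lemma sorted_eigenvalues (R : rcfType) (n : nat) (A : 'M[R]_n) :
  sorted >=%R (eigenvalues A).
Proof.
rewrite /eigenvalues.
have : sorted >%R (rev (rootsR (char_poly A))).
  by rewrite rev_sorted; apply: sorted_roots.
elim: (rev _) => //= x s IHs ltx.
set m := mup _ _; rewrite (sorted_pairwise ge_trans) pairwise_cat.
rewrite -!(sorted_pairwise ge_trans) IHs ?(path_sorted ltx) // andbT.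
apply/andP; split.
  apply/allrelP => y z /nseqP[-> _] /flattenP[t /mapP[w sw ->]] /nseqP[-> _].
  by move: ltx; rewrite (path_sortedE (rev_trans lt_trans)) => /andP[/allP/(_ w sw)/ltW].
by case: m => //=; elim=> //= m ->; rewrite lexx.
Qed.

(** One half of Courant-Fischer: two eigenvalues at least [c] would give a plane of vectors, and
    this plane meets the hyperplane [x *m l = 0] in a nonzero [x] on which the form is at least [c]
    times the squared norm. With [1 < n], entry 1 is a genuine eigenvalue and not the default 0 of
    [nth]. *)
Lemma second_eigenvalue_lt (R : rcfType) (n : nat) (A : 'M[R]_n) (l : 'cV[R]_n)
    (c : R) :
  (1 < n)%N -> A^T = A ->
  (forall x : 'rV[R]_n, x != 0 -> x *m l = 0 ->
     (x *m A *m x^T) 0 0 < c * (x *m x^T) 0 0) ->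
  (eigenvalues A)`_1 < c.
Proof.
move=> n_gt1 symA negA.
have [P unitP [d PA]] := real_symmetric_diagonalizable _ _ _ symA.
have permA : perm_eq (eigenvalues A) [seq d 0 i | i <- enum 'I_n].
  apply: perm_eigenvalues; rewrite big_map big_enum.
  exact: char_poly_diagonalized PA.
rewrite ltNge; apply/negP => le_c.
have [i [j [neq_ij le_ci le_cj]]] :
    exists i, exists j, [/\ i != j, c <= d 0 i & c <= d 0 j].
  have : (1 < count (>= c) (eigenvalues A))%N.
    have := perm_size permA; rewrite size_map size_enum_ord.
    move: (sorted_eigenvalues _ _ A) le_c.
    case: (eigenvalues A) => [|x [|y s]] /=;
      try by move=> _ _ n_eq; rewrite -n_eq in n_gt1.
    by move=> /andP[le_yx _] le_cy; rewrite le_cy (le_trans le_cy le_yx).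
  (* Counting indices instead of values yields distinct [i] and [j] even for a repeated
     eigenvalue. *)
  rewrite (permP permA) count_map -size_filter.
  set t := filter _ _; have : uniq t by rewrite filter_uniq ?enum_uniq.
  have : all (fun i => c <= d 0 i) t by apply: filter_all.
  case: t => [|i [|j t]] //= /and3P[ci cj _] /andP[]; rewrite inE negb_or.
  by case/andP=> neq_ij _ _ _; exists i, j.
have rowA k : row k P *m A = d 0 k *: row k P.
  by rewrite -row_mul PA mul_diag_mx; apply/rowP => m; rewrite !mxE.
pose dot (u v : 'rV[R]_n) := (u *m v^T) 0 0.
have dotC u v : dot u v = dot v u.
  by rewrite /dot -[u *m v^T]trmxK trmx_mul trmxK mxE.
have dot_ge0 u : 0 <= dot u u.
  rewrite /dot mxE; apply: sumr_ge0 => k _; rewrite mxE -expr2; exact: sqr_ge0.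
have dotAC : d 0 i * dot (row i P) (row j P) = d 0 j * dot (row i P) (row j P).
  transitivity ((row i P *m A *m (row j P)^T) 0 0).
    by rewrite rowA -scalemxAl mxE.
  rewrite -mulmxA -{1}symA -trmx_mul rowA linearZ /= -scalemxAr.
  by rewrite mxE.
have [a [b [nz_ab ab_l]]] : exists a, exists b,
    (a != 0) || (b != 0) /\ (a *: row i P + b *: row j P) *m l = 0.
  have lE (u : 'rV_n) : u *m l = ((u *m l) 0 0)%:M by rewrite -mx11_scalar.
  set u := row i P; set v := row j P.
  (* Either [v] already lies in the hyperplane, or [(v l) u - (u l) v] does. *)
  have [v0|nzv] := eqVneq ((v *m l) 0 0) 0.
    exists 0, 1; rewrite oner_neq0 orbT scale0r add0r scale1r.
    by rewrite lE v0 raddf0.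
  exists ((v *m l) 0 0), (- (u *m l) 0 0); rewrite nzv; split=> //.
  rewrite mulmxDl -!scalemxAl (lE u) (lE v) !scale_scalar_mx !mxE -raddfD /=.
  by rewrite !mulr1n mulNr mulrC subrr raddf0.
set x := _ + _ in ab_l.
have nzx : x != 0.
  pose w := a *: delta_mx 0 i + b *: delta_mx 0 j : 'rV[R]_n.
  have -> : x = w *m P by rewrite /x !rowE !scalemxAl -mulmxDl.
  rewrite -(mul0mx _ P) (inj_eq (can_inj (mulmxK unitP))).
  apply: contraTneq nz_ab => /rowP w0; rewrite negb_or !negbK.
  have := w0 i; have := w0 j; rewrite !mxE !eqxx eq_sym (negbTE neq_ij) /=.
  by rewrite !mulr0 !mulr1 addr0 add0r => -> ->; rewrite eqxx.
have := negA x nzx ab_l; rewrite ltNge => /negP[].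
pose u := row i P; pose v := row j P.
have dotx a1 b1 a2 b2 : dot (a1 *: u + b1 *: v) (a2 *: u + b2 *: v) =
    a1 * a2 * dot u u + b1 * b2 * dot v v + (a1 * b2 + b1 * a2) * dot u v.
  have -> : (a1 * b2 + b1 * a2) * dot u v = a1 * b2 * dot u v + b1 * a2 * dot v u.
    by rewrite (dotC v u) mulrDl.
  rewrite /dot linearD !linearZ /= mulmxDl !mulmxDr -!scalemxAl -!scalemxAr.
  by rewrite !mxE; ring.
have xAE : x *m A = (a * d 0 i) *: u + (b * d 0 j) *: v.
  by rewrite mulmxDl -!scalemxAl !rowA !scalerA.
rewrite -/(dot (x *m A) x) -/(dot x x) xAE.
(* For equal eigenvalues [u] and [v] may fail to be orthogonal, but [x] is itself an eigenvector.
   For distinct ones [dotAC] forces orthogonality and the mixed terms vanish. *)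
have [eq_d|neq_d] := eqVneq (d 0 i) (d 0 j).
  rewrite eq_d -![_ * d 0 j]mulrC -!scalerA -scalerDr /dot -scalemxAl [leRHS]mxE.
  by rewrite ler_wpM2r ?dot_ge0.
have uv0 : dot u v = 0.
  apply/eqP; have /eqP := dotAC; rewrite -subr_eq0 -mulrBl mulf_eq0 subr_eq0.
  by rewrite (negbTE neq_d).
have term_ge0 k z w : c <= d 0 k -> 0 <= w -> 0 <= (d 0 k - c) * (z ^+ 2 * w).
  by move=> ck w_ge0; rewrite mulr_ge0 ?subr_ge0 // mulr_ge0 ?sqr_ge0.
have := term_ge0 i a (dot u u) le_ci (dot_ge0 u).
have := term_ge0 j b (dot v v) le_cj (dot_ge0 v).
rewrite !dotx uv0; lra.
Qed.

(** * Lower bounds for adjacency forms *)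

(** The sum is over ordered pairs, so each edge contributes twice, as in y A y^T. *)
Definition adj_form (R : pzRingType) (G : sgraph) (y : G -> R) : R :=
  \sum_u \sum_v (sedge u v)%:R * (y u * y v).

(** Says that the least adjacency eigenvalue is at least [- c], in a form that adds up over
    components. *)
Definition adj_bound (R : numDomainType) (c : R) (G : sgraph) : Prop :=
  forall y : G -> R, - (c * \sum_u y u ^+ 2) <= adj_form R G y.

Lemma sum_eq_form (R : pzRingType) (T : finType) (y : T -> R) :
  \sum_u \sum_v (u == v)%:R * (y u * y v) = \sum_u y u ^+ 2.
Proof.
apply: eq_bigr => u _; rewrite (bigD1 u) //= eqxx mul1r big1 ?addr0 //.
by move=> v; rewrite eq_sym => /negbTE ->; rewrite mul0r.
Qed.

Lemma adj_form_complete (R : pzRingType) (m : nat) (y : complete_graph m -> R) :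
  adj_form R (complete_graph m) y = (\sum_u y u) ^+ 2 - \sum_u y u ^+ 2.
Proof.
rewrite -sum_eq_form /adj_form expr2 mulr_suml -sumrB; apply: eq_bigr => u _.
rewrite mulr_sumr -sumrB; apply: eq_bigr => v _.
by rewrite /= /complete_edge; case: eqP => _; rewrite ?mul1r ?mul0r ?subr0 ?subrr.
Qed.

(** Keeping [cross] as a variable treats join and disjoint union at once; the cross edges form a
    complete bipartite graph, whose form factors. *)
Lemma adj_form_sum (R : comPzRingType) (G1 G2 : sgraph) (cross : bool)
    (y : G1 + G2 -> R) :
  adj_form R (SGraph (@sum_edge_sym G1 G2 cross) (@sum_edge_irr G1 G2 cross)) y =
  adj_form R G1 (y \o inl) + adj_form R G2 (y \o inr) +
  cross%:R * 2 * ((\sum_u y (inl u)) * (\sum_v y (inr v))).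
Proof.
rewrite /adj_form /= big_sumType /=.
under eq_bigr => u _ do rewrite big_sumType /=.
under [X in _ + X]eq_bigr => u _ do rewrite big_sumType /=.
rewrite !big_split /=.
have -> : \sum_u \sum_v cross%:R * (y (inl u) * y (inr v)) =
    cross%:R * ((\sum_u y (inl u)) * (\sum_v y (inr v))).
  rewrite mulr_suml mulr_sumr; apply: eq_bigr => u _.
  by rewrite mulr_sumr mulr_sumr.
have -> : \sum_u \sum_v cross%:R * (y (inr u) * y (inl v)) =
    cross%:R * ((\sum_u y (inl u)) * (\sum_v y (inr v))).
  rewrite exchange_big mulr_suml mulr_sumr; apply: eq_bigr => u _.
  by rewrite mulr_sumr mulr_sumr; apply: eq_bigr => v _; rewrite [y _ * _]mulrC.
ring.
Qed.

Lemma sum_pair (V : nmodType) (I J : finType) (F : I * J -> V) :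
  \sum_z F z = \sum_i \sum_j F (i, j).
Proof. by rewrite pair_bigA; apply: eq_bigr => -[i j]. Qed.

Lemma adj_form_copies (R : pzRingType) (m : nat) (G : sgraph)
    (y : copies m G -> R) :
  adj_form R (copies m G) y = \sum_i adj_form R G (fun u => y (i, u)).
Proof.
rewrite /adj_form sum_pair; apply: eq_bigr => i _; apply: eq_bigr => u _.
rewrite sum_pair (bigD1 i) //= [X in _ + X]big1 ?addr0.
  by apply: eq_bigr => v _; rewrite /copies_edge eqxx.
move=> j neq_ji; apply: big1 => v _.
by rewrite /copies_edge /= eq_sym (negbTE neq_ji) mul0r.
Qed.

(** Since A = J - I, adding [c] times the squared norm gives a square plus [c - 1] times that
    norm. *)
Lemma adj_bound_complete (R : realDomainType) (c : R) (m : nat) :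
  1 <= c -> adj_bound R c (complete_graph m).
Proof.
move=> c_ge1 y; rewrite adj_form_complete.
have : 0 <= (c - 1) * \sum_u y u ^+ 2.
  by rewrite mulr_ge0 ?subr_ge0 ?sumr_ge0 // => u _; apply: sqr_ge0.
have := sqr_ge0 (\sum_u y u).
lra.
Qed.

Lemma adj_bound_union (R : realDomainType) (c : R) (G1 G2 : sgraph) :
  adj_bound R c G1 -> adj_bound R c G2 -> adj_bound R c (disjoint_union G1 G2).
Proof.
move=> bG1 bG2 y; rewrite adj_form_sum !mul0r addr0 big_sumType /= mulrDr opprD.
exact: lerD (bG1 _) (bG2 _).
Qed.

Lemma adj_bound_copies (R : realDomainType) (c : R) (m : nat) (G : sgraph) :
  adj_bound R c G -> adj_bound R c (copies m G).
Proof.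
move=> bG y; rewrite adj_form_copies.
have -> : \sum_u y u ^+ 2 = \sum_i \sum_u y (i, u) ^+ 2.
  by rewrite pair_bigA /=; apply: eq_bigr => -[].
by rewrite mulr_sumr -sumrN; apply: ler_sum => i _; apply: bG.
Qed.

(* The least adjacency eigenvalue of the paw is about -1.4812. *)
Lemma adj_bound_paw (R : realFieldType) :
  adj_bound R (149 / 100)
    (join_graph (complete_graph 1)
       (disjoint_union (complete_graph 1) (complete_graph 2))).
Proof.
move=> y; rewrite !adj_form_sum !adj_form_complete !big_sumType /=.
rewrite !(big_ord_recl, big_ord0) /= !addr0.
set h := y _; set a := y _; set b := y _; set b' := y _.
(* Completing squares with c = 149/100: the shifts are h/c and 2h/(c+1), the coefficient of (b -
   b')^2 is (c-1)/2, and h^2 keeps c - 1/c - 2/(c+1) > 0. *)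
have := sqr_ge0 (a + 100 / 149 * h).
have := sqr_ge0 (b + b' + 200 / 249 * h).
have := sqr_ge0 (b - b').
have := sqr_ge0 h.
nra.
Qed.

(** * Distances and the distance form of a cone *)

Lemma walk_of_lengthP (G : sgraph) (u v : G) (k : nat) :
  reflect (exists w, [/\ size w = k, path (@sedge G) u w & last u w = v])
    (walk_of_length u v k).
Proof.
apply: (iffP existsP) => [[w /andP[pw /eqP lw]]|[w [szw pw lw]]].
  by exists w; rewrite size_tuple.
by exists (tcast szw (in_tuple w)); rewrite val_tcast pw lw eqxx.
Qed.

Lemma gdist_diameter2 (G : sgraph) (u v : G) :
  (u != v -> ~~ sedge u v -> exists w, sedge u w && sedge w v) ->
  gdist u v = ((u != v) + ((u != v) && ~~ sedge u v))%N.
Proof.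
move=> diam2.
have walk0 : walk_of_length u v 0 = (u == v).
  apply/walk_of_lengthP/eqP => [[w [/size0nil -> _ //]]|->].
  by exists [::].
have walk1 : walk_of_length u v 1 = sedge u v.
  apply/walk_of_lengthP/idP => [[w [szw pw lw]]|uv].
    by case: w szw pw lw => [|w [|]] //= _; rewrite andbT => uw <-.
  by exists [:: v]; rewrite /= uv.
have walk2 : u != v -> ~~ sedge u v -> walk_of_length u v 2.
  move=> neq_uv nuv; have [w /andP[uw wv]] := diam2 neq_uv nuv.
  by apply/walk_of_lengthP; exists [:: w; v]; rewrite /= uw wv.
rewrite /gdist; have [eq_uv|neq_uv] /= := eqVneq u v.
  have : (0 < #|G|)%N by apply/card_gt0P; exists u.
  by case: #|G| => //= n _; rewrite walk0 eq_uv eqxx.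
have : (1 < #|G|)%N by apply/card_gt1P; exists u, v.
case: #|G| => [|[|n]] //= _; rewrite walk0 walk1 (negbTE neq_uv).
have [//|nuv] := boolP (sedge u v).
(* If [G] has only two vertices, the failed search returns the list length, which is also 2. *)
by case: n => //= n; rewrite walk2.
Qed.

Lemma gdist_cone (H : sgraph) (u v : join_graph (complete_graph 1) H) :
  gdist u v = ((u != v) + ((u != v) && ~~ sedge u v))%N.
Proof.
apply: gdist_diameter2 => neq_uv nuv; exists (inl ord0).
case: u v neq_uv nuv => [u|u] [v|v] //=.
by rewrite [u]ord1 [v]ord1 eqxx.
Qed.

(** The entries of D = 2J - 2I - A, where A belongs to the whole cone, apex included. *)
Lemma gdist_cone_ring (R : pzRingType) (H : sgraph)
    (u v : join_graph (complete_graph 1) H) :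
  (gdist u v)%:R = 2 - (u == v)%:R * 2 - (sedge u v)%:R :> R.
Proof.
rewrite gdist_cone; have [->|_] := eqVneq u v.
  by rewrite sedge_irr mul1r subr0 subrr.
by rewrite mul0r subr0; case: (sedge u v); rewrite ?subr0 // mulr2n addrK.
Qed.

Lemma dist_form_cone (R : comPzRingType) (H : sgraph)
    (x : 'rV[R]_#|join_graph (complete_graph 1) H|) :
  let y u := x 0 (enum_rank u) in
  (x *m dist_mx (join_graph (complete_graph 1) H) R *m x^T) 0 0 =
  2 * (\sum_u y u) ^+ 2 - 2 * (\sum_u y u ^+ 2) - adj_form R _ y.
Proof.
move=> y.
have xE i : x 0 i = y (enum_val i) by rewrite /y enum_valK.
have -> : (x *m dist_mx (join_graph (complete_graph 1) H) R *m x^T) 0 0 =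
    \sum_u \sum_v (gdist u v)%:R * (y u * y v).
  rewrite exchange_big mxE [RHS]big_enum_val; apply: eq_bigr => j _.
  rewrite !mxE mulr_suml [RHS]big_enum_val; apply: eq_bigr => i _.
  by rewrite mxE !xE mulrAC mulrA mulrC mulrA.
rewrite -sum_eq_form /adj_form expr2 mulr_suml !mulr_sumr -!sumrB.
apply: eq_bigr => u _; rewrite !mulr_sumr -!sumrB; apply: eq_bigr => v _.
by rewrite gdist_cone_ring; ring.
Qed.

Lemma dist_eigenvalue2_cone (R : rcfType) (c : R) (H : sgraph) :
  (0 < #|H|)%N -> c < 3 / 2 -> adj_bound R c H ->
  dist_eigenvalue R (join_graph (complete_graph 1) H) 2 < - (1 / 2).
Proof.
move=> H_gt0 c_lt bH.
apply: (second_eigenvalue_lt _ _ _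
  (* This column defines the hyperplane t + 2S = 0: weight 1 at the apex, 2 on [H]. *)
  (\col_i if enum_val i is inl _ then 1 else 2)) => [||x nzx].
- by rewrite card_sum card_ord add1n ltnS.
- apply/matrixP=> i j; rewrite !mxE !gdist_cone_ring eq_sym.
  by rewrite sedge_sym.
rewrite dist_form_cone; set y := fun u => x 0 (enum_rank u) => x_l.
have xE i : x 0 i = y (enum_val i) by rewrite /y enum_valK.
have -> : (x *m x^T) 0 0 = \sum_u y u ^+ 2.
  rewrite mxE [RHS]big_enum_val; apply: eq_bigr => i _.
  by rewrite mxE xE expr2.
have nzy : 0 < \sum_u y u ^+ 2.
  rewrite lt_def sumr_ge0 ?andbT => [|u _]; last exact: sqr_ge0.
  apply: contra_neq nzx => /eqP; rewrite psumr_eq0 => [/allP y0|u _]; last first.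
    exact: sqr_ge0.
  apply/rowP=> i; rewrite xE mxE; apply/eqP.
  by rewrite -sqrf_eq0; apply: y0; rewrite mem_index_enum.
have tE : y (inl ord0) + 2 * \sum_v y (inr v) = 0.
  have /matrixP/(_ 0 0) := x_l; rewrite [RHS]mxE => {2}<-.
  transitivity (\sum_u y u * (if u is inl _ then 1 else 2)).
    by rewrite big_sumType /= big_ord1 mulr1 -mulr_suml [2 * _]mulrC.
  by rewrite big_enum_val mxE; apply: eq_bigr => i _; rewrite mxE xE.
move: nzy (bH (y \o inr)); rewrite adj_form_sum adj_form_complete !big_sumType /=.
rewrite !big_ord1 -/(y (inl ord0)).
set S := \sum_v y (inr v) in tE *; set N := \sum_v y (inr v) ^+ 2.
have -> : y (inl ord0) = - (2 * S) by apply/eqP; rewrite -addr_eq0 tE.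
set a := adj_form _ _ _ => nzy bHy.
(* If [y] vanished on [H], then S = 0 and the apex entry -2S would vanish too, contradicting
   [nzy]. *)
have N_gt0 : 0 < N.
  rewrite lt_def sumr_ge0 ?andbT => [|v _]; last exact: sqr_ge0.
  apply: contraTneq nzy => N0; have S0 : S = 0.
    apply: big1 => v _; apply/eqP; rewrite -sqrf_eq0; apply/eqP.
    by apply: (psumr_eq0P _ N0) => // w _; apply: sqr_ge0.
  by rewrite N0 S0 mulr0 oppr0 expr0n addr0 ltxx.
(* After substituting t = -2S, the form of D + I/2 equals -a - 3N/2, and [bHy] bounds it by -(3/2 -
   c)N; this slack gives strictness. *)
have : 0 < (3 / 2 - c) * N by rewrite mulr_gt0 ?subr_gt0.
lra.
Qed.

Theorem theorem4 (R : rcfType) (r p q : nat)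
  (hr : (1 <= r)%N) (hp : (1 <= p)%N) (hq : (1 <= q)%N) :
  dist_eigenvalue R (graph_rpq r p q) 2 < - (1 / 2).
Proof.
(* A single constant has to serve everywhere: at least 1 for the complete graphs, at least about
   1.4812 for the paws, and below 3/2 for the cone. *)
apply: (@dist_eigenvalue2_cone _ (149 / 100)).
- by rewrite card_sum card_prod !card_ord addn_gt0 muln_gt0 hp hr.
- lra.
apply: adj_bound_union; apply: adj_bound_copies; last exact: adj_bound_paw.
by apply: adj_bound_complete; lra.
Qed.
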